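(* Let $M,K,P$ be positive integers with $M\le\min\{P,K\}$, let $p_0>0$, let $\mathbf H\in\mathbb C^{P\times K}$ be nonzero, and let $\mathbf R_{vv}\in\mathbb C^{P\times P}$ be Hermitian positive definite. Let $\mathbf H^H\mathbf R_{vv}^{-1}\mathbf H=\mathbf V\boldsymbol\Lambda\mathbf V^H$ be an eigenvalue decomposition with $\mathbf V$ unitary and eigenvalues $\lambda_1\ge\cdots\ge\lambda_K\ge0$. Let $r\le K$ be the largest integer with $\lambda_r>0$ and $\frac1{\lambda_r}<\frac1r\bigl(p_0+\sum_{j=1}^r\lambda_j^{-1}\bigr)$, let $q=\min\{r,M\}$, let $\tilde{\mathbf V}_q$ be the first $q$ columns of $\mathbf V$, let $\boldsymbol\Phi$ be the $q\times q$ diagonal matrix with positive diagonal entries satisfying $|\phi_{ii}|^2=\frac1q\bigl(p_0+\sum_{j=1}^q\lambda_j^{-1}\bigr)-\lambda_i^{-1}$, let $\breve{\boldsymbol\Phi}=[\,\boldsymbol\Phi\ \ \mathbf 0_{q\times(M-q)}\,]$, and let $\boldsymbol\Psi_{\rm MMSE}$ be an $M\times M$ unitary matrix such that the upper-triangular factor in the QR decomposition of $(\mathbf I_M+\breve{\boldsymbol\Phi}^T\operatorname{diag}(\lambda_1,\dots,\lambda_q)\breve{\boldsymbol\Phi})^{1/2}\boldsymbol\Psi_{\rm MMSE}$ has equal diagonal entries. Then the precoder $$\mathbf F_\star=\tilde{\mathbf V}_q\breve{\boldsymbol\Phi}\boldsymbol\Psi_{\rm MMSE}$$ satisfies $\operatorname{tr}(\mathbf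 F_\star\mathbf F_\star^H)\le p_0$ and, among all $\mathbf F\in\mathbb C^{K\times M}$ with $\operatorname{tr}(\mathbf F\mathbf F^H)\le p_0$, (a) minimizes the geometric mean-square error $|\mathbf R_{ee,\rm MMSE}(\mathbf F,\mathbf B)|^{1/M}$ (which does not depend on the strictly upper triangular matrix $\mathbf B$), and (b) maximizes the Gaussian mutual information $\log\bigl|\mathbf I+\mathbf F^H\mathbf H^H\mathbf R_{vv}^{-1}\mathbf H\mathbf F\bigr|$.
   Context: All matrices are complex; $(\cdot)^H$ is the conjugate transpose, $(\cdot)^T$ the transpose, $|\cdot|$ the determinant. For a precoder $\mathbf F\in\mathbb C^{K\times M}$ and a strictly upper triangular feedback matrix $\mathbf B\in\mathbb C^{M\times M}$, the error covariance matrix of the minimum mean-square error block decision feedback detector (MMSE-BDFD), assuming correct past decisions, is $$\mathbf R_{ee,\rm MMSE}(\mathbf F,\mathbf B)=(\mathbf B+\mathbf I)\bigl(\mathbf I+\mathbf F^H\mathbf H^H\mathbf R_{vv}^{-1}\mathbf H\mathbf F\bigr)^{-1}(\mathbf B+\mathbf I)^H,$$ and its geometric mean-square error is $|\mathbf R_{ee,\rm MMSE}(\mathbf F,\mathbf B)|^{1/M}$. The Gaussian mutual information between transmitter and receiver for the model $\mathbf y=\mathbf H\mathbf F\mathbf s+\mathbf v$ (with $\mathbf s$ and $\mathbf v$ independent circular Gaussian of covariance $\mathbf I$ and $\mathbf R_{vv}$) is $\log|\mathbf I+\mathbf F^H\mathbf H^H\mathbf R_{vv}^{-1}\mathbf H\mathbf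 F|$. *)

(* Defs.v *)
From HB Require Import structures.
From mathcomp Require Export all_boot all_order all_algebra.
From mathcomp Require Export complex reals exp.
Set Implicit Arguments.
Unset Strict Implicit.
Unset Printing Implicit Defensive.
Import Order.TTheory GRing.Theory Num.Theory.
Local Open Scope ring_scope.
Local Open Scope complex_scope.
Local Open Scope sesquilinear_scope.

(* Complex matrices are matrices over R[i] with R : realType.
   On R[i] the relations <= and < are the partial order of numeric fields: in
   particular 0 <= z and 0 < z assert that z is real. *)

Section Matrices.
Variable C : numClosedFieldType.

Definition posdefmx n (A : 'M[C]_n) : Prop :=
  A^t* = A /\ forall x : 'cV[C]_n, x != 0 -> 0 < (x^t* *m A *m x) 0 0.

Definition possemidefmx n (A : 'M[C]_n) : Prop :=
  A^t* = A /\ forall x : 'cV[C]_n, 0 <= (x^t* *m A *m x) 0 0.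

(* S = A^{1/2}, the (unique) positive semidefinite square root. *)
Definition is_sqrtmx n (A S : 'M[C]_n) : Prop :=
  possemidefmx S /\ S *m S = A.

Definition upper_triangular n (U : 'M[C]_n) : Prop :=
  forall i j : 'I_n, (j < i)%N -> U i j = 0.

Definition strictly_upper_triangular n (B : 'M[C]_n) : Prop :=
  forall i j : 'I_n, (j <= i)%N -> B i j = 0.

(* A = QU; the diagonal of U is normalised to be positive, which makes the
   factors of an invertible A unique. *)
Definition is_QR n (A Q U : 'M[C]_n) : Prop :=
  [/\ A = Q *m U, Q \is unitarymx, upper_triangular U
    & forall i, 0 < U i i].

End Matrices.

Section Waterfilling.
Variables (R : realType) (K : nat).
Implicit Types (lam : 'rV[R]_K).

(* Indices start at 0, so k : 'I_K stands for the integer k + 1. *)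
Definition channel_active (p0 : R) lam (k : 'I_K) : Prop :=
  0 < lam 0 k /\
  (lam 0 k)^-1 < k.+1%:R^-1 * (p0 + \sum_(j < K | (j <= k)%N) (lam 0 j)^-1).

Definition is_largest_active (p0 : R) lam (r : nat) : Prop :=
  (exists2 k : 'I_K, channel_active p0 lam k & r = k.+1) /\
  (forall k : 'I_K, channel_active p0 lam k -> (k.+1 <= r)%N).

End Waterfilling.

Lemma minn_le_dim (M P K r q : nat) :
  (M <= minn P K)%N -> q = minn r M -> (q <= K)%N /\ (q <= M)%N.
Proof.
by rewrite leq_min => /andP[_ MK] ->; rewrite geq_minr (leq_trans _ MK) ?geq_minr.
Qed.

Section BlockDFD.
Variables (R : realType) (M K P : nat).
Implicit Types (H : 'M[R[i]]_(P, K)) (Rvv : 'M[R[i]]_P).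
Implicit Types (F : 'M[R[i]]_(K, M)) (B : 'M[R[i]]_M).

Definition snr_mx H Rvv F : 'M[R[i]]_M :=
  1%:M + F^t* *m H^t* *m invmx Rvv *m H *m F.

Definition Ree_MMSE H Rvv F B : 'M[R[i]]_M :=
  (B + 1%:M) *m invmx (snr_mx H Rvv F) *m (B + 1%:M)^t*.

(* For M > 0 and a determinant >= 0, M.-root is the nonnegative M-th root. *)
Definition geometric_MSE H Rvv F B : R[i] :=
  M.-root (\det (Ree_MMSE H Rvv F B)).

(* The determinant is a positive real, whence the real part. *)
Definition mutual_info H Rvv F : R :=
  ln (complex.Re (\det (snr_mx H Rvv F))).

Definition power_feasible (p0 : R) F : Prop := \tr (F *m F^t*) <= p0%:C.

End BlockDFD.

Section Precoder.
Variable R : realType.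

Definition first_cols (m K q : nat) (hq : (q <= K)%N) (V : 'M[R[i]]_(m, K)) :
  'M[R[i]]_(m, q) := colsub (widen_ord hq) V.

Definition pad_cols (m q M : nat) (hq : (q <= M)%N) (A : 'M[R[i]]_(m, q)) :
  'M[R[i]]_(m, M) :=
  castmx (erefl m, subnKC hq) (row_mx A (0 : 'M[R[i]]_(m, M - q))).

End Precoder.

(* Main.v *)
(** Let [U] be a unitary diagonalising [F^H H^H Rvv^-1 H F].  The columns [y_i] of [V^H F U] are
orthogonal for the form [Lambda]; let [d_i] be their squared lengths for it.  Then
[|I + F^H H^H Rvv^-1 H F| = prod (1 + d_i)], and the weights [a_ik = lambda_k |y_ik|^2 / d_i] are
doubly substochastic.  Let [mu] be the water level.  The tangent-line bound
[ln (1 + d) <= ln t + 1/t - 1 + d/t] at [t = mu lambda_k] for [k < q], and at [t = 1] or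
[t = mu lambda_(q-1)] (the weakest active channel) for [k >= q], averaged with these weights, turns
the power constraint into [sum ln (1 + d_i) <= sum_(k < q) ln (mu lambda_k)]; the right-hand side is
attained by [F_star].  The determinant of the error covariance is the inverse of the same
determinant, since [B + I] is unitriangular. *)
Require Import Defs.
From mathcomp Require Import lra ring.
Import Order.TTheory GRing.Theory Num.Theory.
Local Open Scope ring_scope.
Local Open Scope complex_scope.
Local Open Scope sesquilinear_scope.

(** * Scalar inequalities behind water-filling *)

Section Scalar.
Context {R : realType}.

(** Intercept at [d = 0] of the tangent to [ln (1 + d)] at [1 + d = t]; the slope of that tangent is
    [1/t]. *)
Definition log_gap (t : R) : R := ln t + t^-1 - 1.

Lemma ln_le_subr1 (x : R) : 0 < x -> ln x <= x - 1.
Proof.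
move=> x0; rewrite [in ln x](_ : x = 1 + (x - 1)); last lra.
by apply: le_ln1Dx; lra.
Qed.

Lemma ln1D_le_log_gap (t d : R) : 0 < t -> 0 <= d -> ln (1 + d) <= log_gap t + d / t.
Proof.
move=> t0 d0; have d1 : 0 < 1 + d by lra.
have := ln_le_subr1 ((1 + d) / t) (divr_gt0 d1 t0).
rewrite lnM ?lnV ?posrE ?invr_gt0 // mulrDl mul1r /log_gap; lra.
Qed.

(** The derivative [(1 - 1/t)/t] is nonnegative for [t >= 1]. Without calculus:
    [ln (s/t) <= s/t - 1] bounds the increment below by [(1 - s/t) * (1 - 1/s)]. *)
Lemma log_gap_homo (s t : R) : 1 <= s -> s <= t -> log_gap s <= log_gap t.
Proof.
move=> s1 st; have s0 : 0 < s by lra. have t0 : 0 < t by lra.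
have := ln_le_subr1 (s / t) (divr_gt0 s0 t0).
rewrite lnM ?lnV ?posrE ?invr_gt0 // => h.
suff : 0 <= (1 - s / t) * (1 - s^-1).
  by rewrite mulrBr mulr1 mulrBl mul1r mulrAC divff ?gt_eqF // mul1r /log_gap; lra.
apply: mulr_ge0; first by rewrite subr_ge0 ler_pdivrMr // mul1r.
by rewrite subr_ge0 invf_le1.
Qed.

(** Write [c k = (c k - g) + g]. The excess is nonnegative for [k < q] and zero beyond, so column
    sums control it; row sums give total mass at most [M] to the constant [g]. The condition
    [M * g = q * g] covers both [q = M] and [g = 0]. *)
Lemma substochastic_sum_le (M K q : nat) (a : 'I_M -> 'I_K -> R) (c : 'I_K -> R) (g : R) :
  (q <= K)%N -> (forall i k, 0 <= a i k) ->
  (forall k, \sum_i a i k <= 1) -> (forall i, \sum_k a i k <= 1) ->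
  0 <= g -> (forall k : 'I_K, (k < q)%N -> g <= c k) ->
  (forall k : 'I_K, (q <= k)%N -> c k = g) -> M%:R * g = q%:R * g ->
  \sum_i \sum_k a i k * c k <= \sum_(k < K | (k < q)%N) c k.
Proof.
move=> qK a0 acol arow g0 cge ceq Mg.
have -> : \sum_(k < K | (k < q)%N) c k =
    \sum_(k < K | (k < q)%N) (c k - g) + M%:R * g.
  rewrite Mg sumrB; have -> : \sum_(k < K | (k < q)%N) g = q%:R * g; last lra.
  by rewrite (big_ord_narrow qK) sumr_const card_ord mulr_natl.
have -> : \sum_i \sum_k a i k * c k =
    \sum_k (\sum_i a i k) * (c k - g) + (\sum_i \sum_k a i k) * g.
  rewrite [LHS]exchange_big [\sum_i \sum_k a i k]exchange_big mulr_suml -big_split /=.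
  by apply: eq_bigr => k _; rewrite -mulr_suml; lra.
apply: lerD.
  rewrite [leRHS]big_mkcond; apply: ler_sum => k _.
  case: ltnP => [kq|qk]; last by rewrite ceq // subrr mulr0.
  by rewrite -[leRHS]mul1r ler_wpM2r ?subr_ge0 ?cge.
apply: ler_wpM2r => //.
rewrite -[M in leRHS]card_ord -sumr_const.
exact: ler_sum.
Qed.

(* [p i k] is the power that data stream [i] spends in eigendirection [k]. *)
Lemma waterfilling_log_bound (M K q : nat) (lam : 'I_K -> R) (mu p0 : R)
    (d : 'I_M -> R) (p : 'I_M -> 'I_K -> R) :
  (0 < q)%N -> (q <= K)%N -> (q <= M)%N -> 0 < mu ->
  (forall k, 0 <= lam k) -> (forall j k : 'I_K, (j <= k)%N -> lam k <= lam j) ->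
  (forall k : 'I_K, (k < q)%N -> 1 < mu * lam k) ->
  ((q < M)%N -> forall k : 'I_K, (q <= k)%N -> mu * lam k <= 1) ->
  q%:R * mu = p0 + \sum_(k < K | (k < q)%N) (lam k)^-1 ->
  (forall i, 0 <= d i) -> (forall i k, 0 <= p i k) ->
  (forall i, \sum_k p i k * lam k = d i) ->
  (forall k, \sum_i p i k * lam k / d i <= 1) ->
  \sum_i \sum_k p i k <= p0 ->
  \sum_i ln (1 + d i) <= \sum_(k < K | (k < q)%N) ln (mu * lam k).
Proof.
move=> q0 qK qM mu0 lam0 lamD act inact muE d0 p0' drow acol pw.
have q1K : (q.-1 < K)%N by rewrite prednK.
pose kq := Ordinal q1K.
(* If [q < M], channels past [q] satisfy [mu * lam k <= 1] and the tangent at [t = 1] has intercept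
   0. If [q = M] they may still lie above that threshold, and the weakest used channel supplies the
   tangent. *)
pose g := if (q < M)%N then 0 else log_gap (mu * lam kq).
pose c (k : 'I_K) := if (k < q)%N then log_gap (mu * lam k) else g.
have gap1 : log_gap 1 = 0 by rewrite /log_gap ln1 invr1; lra.
have act1 : 1 < mu * lam kq by apply: act; rewrite /= prednK.
have g0 : 0 <= g.
  by rewrite /g; case: ifP => // _; rewrite -gap1; apply: log_gap_homo; lra.
have cge (k : 'I_K) : (k < q)%N -> g <= c k.
  move=> kq'; rewrite /c kq' /g; have := act _ kq'; case: ifP => _ h.
    by rewrite -gap1; apply: log_gap_homo; lra.
  apply: log_gap_homo; first lra.
  by rewrite ler_pM2l //; apply: lamD; rewrite -ltnS prednK.
(* For [k >= q] the slope is relaxed to [1 / (mu * lam k)], so that weighting by [a i k] leaves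
   exactly [p i k / mu]. *)
have bnd k x : 0 < lam k -> 0 <= x -> ln (1 + x) <= c k + x / (mu * lam k).
  move=> l0 x0; have ml0 : 0 < mu * lam k by apply: mulr_gt0.
  rewrite /c; case: ltnP => [kq'|qk]; first exact: ln1D_le_log_gap.
  rewrite /g; case: ifP => [qM'|_].
    rewrite add0r; apply: (@le_trans _ _ x).
      by apply: le_ln1Dx; lra.
    by rewrite ler_pdivlMr // ler_piMr // inact.
  have h := ln1D_le_log_gap (mu * lam kq) x (lt_trans ltr01 act1) x0.
  apply: (le_trans h); rewrite lerD2l ler_wpM2l // lef_pV2 ?posrE //; last lra.
  by rewrite ler_pM2l //; apply: lamD; rewrite /= (leq_trans (leq_pred _)).
pose a i k := p i k * lam k / d i.
have a0 i k : 0 <= a i k by rewrite divr_ge0 ?mulr_ge0.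
(* Since [x / 0 = 0], a stream with [d i = 0] has a zero row, which is harmless because
   [ln (1 + 0) = 0]. *)
have arow i : \sum_k a i k = (d i != 0)%:R.
  rewrite -mulr_suml drow; case: eqP => [->|/eqP h]; first by rewrite mul0r.
  by rewrite divff.
have key i : ln (1 + d i) <= \sum_k a i k * c k + mu^-1 * \sum_k p i k.
  have -> : ln (1 + d i) = \sum_k a i k * ln (1 + d i).
    rewrite -mulr_suml arow; case: eqP => [->|_]; last by rewrite mul1r.
    by rewrite addr0 ln1 mulr0.
  rewrite mulr_sumr -big_split /=; apply: ler_sum => k _.
  have pm : 0 <= mu^-1 * p i k by rewrite mulr_ge0 // invr_ge0 ltW.
  have [l0|l0] := eqVneq (lam k) 0.
    by rewrite /a l0 mulr0 !mul0r add0r.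
  have [e0|e0] := eqVneq (d i) 0.
    by rewrite /a e0 invr0 mulr0 !mul0r add0r.
  have l0' : 0 < lam k by rewrite lt_neqAle eq_sym l0 lam0.
  apply: le_trans (ler_wpM2l (a0 i k) (bnd k (d i) l0' (d0 i))) _.
  rewrite mulrDr lerD2l /a.
  suff -> : p i k * lam k / d i * (d i / (mu * lam k)) = mu^-1 * p i k by [].
  by field; rewrite e0 l0 gt_eqF.
apply: le_trans (ler_sum _ (fun i _ => key i)) _.
rewrite big_split /= -mulr_sumr.
have cq (k : 'I_K) : (q <= k)%N -> c k = g by rewrite /c leqNgt => /negbTE ->.
have Mg : M%:R * g = q%:R * g.
  rewrite /g; case: ltnP => [_|Mq]; first by rewrite !mulr0.
  by congr (_%:R * _); apply/eqP; rewrite eqn_leq Mq.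
have arow' i : \sum_k a i k <= 1 by rewrite arow; case: eqP.
have := substochastic_sum_le _ _ _ a c g qK a0 acol arow' g0 cge cq Mg.
(* By the choice of [mu], the terms other than logarithms add up to [- p0 / mu], which cancels the
   bound [p0 / mu] on the power term. *)
have -> : \sum_(k < K | (k < q)%N) c k =
    \sum_(k < K | (k < q)%N) ln (mu * lam k)
    + mu^-1 * \sum_(k < K | (k < q)%N) (lam k)^-1 - q%:R.
  have -> : q%:R = \sum_(k < K | (k < q)%N) 1 :> R.
    by rewrite (big_ord_narrow qK) sumr_const card_ord.
  rewrite mulr_sumr -big_split -sumrB /=; apply: eq_bigr => k kq'.
  by rewrite /c kq' /log_gap invfM.
have -> : \sum_(k < K | (k < q)%N) (lam k)^-1 = q%:R * mu - p0 by rewrite muE; lra.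
rewrite mulrBr mulrCA mulVf ?gt_eqF // mulr1 => h.
have mu0' : 0 <= mu^-1 by rewrite invr_ge0 ltW.
have := ler_wpM2l mu0' pw; move: h; lra.
Qed.
End Scalar.

(** * Logarithms of products, adjoints and a determinant identity *)

Lemma ln_prod (R : realType) (I : finType) (P : pred I) (f : I -> R) :
  (forall i, P i -> 0 < f i) -> ln (\prod_(i | P i) f i) = \sum_(i | P i) ln (f i).
Proof.
move=> f0; have /proj2 // : 0 < \prod_(i | P i) f i /\
    ln (\prod_(i | P i) f i) = \sum_(i | P i) ln (f i).
elim/big_ind2 : _ => [|x1 s1 x2 s2 [p1 e1] [p2 e2]|i Pi]; first by rewrite ln1.
  by rewrite mulr_gt0 // lnM // e1 e2.
by rewrite f0.
Qed.

Section Adjoint.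
Context {C : numClosedFieldType}.

Lemma adjmxE m n (A : 'M[C]_(m, n)) i j : (A^t*) i j = (A j i)^*%R.
Proof. by rewrite !mxE. Qed.

Lemma adjmxM m n p (A : 'M[C]_(m, n)) (B : 'M[C]_(n, p)) :
  (A *m B)^t* = B^t* *m A^t*.
Proof. by rewrite trmx_mul map_mxM. Qed.

Lemma unitary_adjmxK n (U : 'M[C]_n) : U \is unitarymx -> U^t* *m U = 1%:M.
Proof. by rewrite -trmxC_unitary => /unitarymxP; rewrite trmxCK. Qed.

End Adjoint.

(** Sylvester's identity: the block matrix with rows [1, A] and [-B, 1] has two block triangular
    factorisations, whose determinants are the two sides. *)
Lemma det1D_mulmxC (R : comNzRingType) m n (A : 'M[R]_(m, n)) (B : 'M[R]_(n, m)) :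
  \det (1%:M + A *m B) = \det (1%:M + B *m A).
Proof.
have := congr1 determinant (erefl (block_mx 1%:M A (- B) 1%:M)).
have {1}-> : block_mx 1%:M A (- B) 1%:M =
    block_mx 1%:M 0 (- B) 1%:M *m block_mx 1%:M A 0 (1%:M + B *m A).
  rewrite mulmx_block !(mul1mx, mul0mx, mulmx1, mulmx0, addr0, add0r).
  by rewrite mulNmx addrCA addNr addr0.
have -> : block_mx 1%:M A (- B) 1%:M =
    block_mx 1%:M A 0 1%:M *m block_mx (1%:M + A *m B) 0 (- B) 1%:M.
  rewrite mulmx_block !(mul1mx, mul0mx, mulmx1, mulmx0, addr0, add0r).
  by rewrite mulmxN addrK.
by rewrite !det_mulmx !det_lblock !det_ublock !det1 !mul1r !mulr1 => ->.
Qed.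

(** * Splitting the transmitted power into orthogonal streams *)

Section Complex.
Context {R : realType}.

Lemma adjmx_real_diag n (f : 'I_n -> R) :
  (diag_mx (\row_k (f k)%:C))^t* = diag_mx (\row_k (f k)%:C).
Proof.
rewrite tr_diag_mx map_diag_mx; congr diag_mx; apply/rowP => k; rewrite !mxE.
by apply: conj_Creal; rewrite complex_real.
Qed.

(* With [U] diagonalising [Y^t* L Y], [p i k] is the squared modulus of the [k, i] entry of
   [Y *m U^t*]; the bound by 1 is Bessel's inequality for the columns of that matrix. *)
Lemma stream_decomposition (M K : nat) (lam : 'I_K -> R) (Y : 'M[R[i]]_(K, M)) :
  (forall k, 0 <= lam k) ->
  exists (d : 'I_M -> R) (p : 'I_M -> 'I_K -> R),
  [/\ forall i k, 0 <= p i k,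
      forall i, \sum_k p i k * lam k = d i,
      forall k, \sum_i p i k * lam k / d i <= 1,
      \tr (Y *m Y^t*) = (\sum_i \sum_k p i k)%:C
    & \det (1%:M + Y^t* *m diag_mx (\row_k (lam k)%:C) *m Y) = (\prod_i (1 + d i))%:C].
Proof.
move=> lam0; set L := diag_mx _; pose W := Y^t* *m L *m Y.
have Ladj : L^t* = L.
  exact: adjmx_real_diag.
have Wherm : W \is hermsymmx.
  apply/is_hermitianmxP; rewrite expr0 scale1r /W.
  by rewrite !adjmxM trmxCK Ladj mulmxA.
have /hermitian_normalmx /orthomx_spectralP := Wherm.
set U := spectralmx W; set D := spectral_diag W => WE.
have Uu : U \is unitarymx by apply: spectral_unitarymx.
have UU : U *m U^t* = 1%:M by apply/unitarymxP.
rewrite invmx_unitary // in WE.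
(* Rotating the streams by [U^t*] makes the columns [L]-orthogonal and preserves the total power. *)
have [T [TLT trT]] : exists T : 'M[R[i]]_(K, M),
    T^t* *m L *m T = diag_mx D /\ \tr (Y *m Y^t*) = \tr (T *m T^t*).
  exists (Y *m U^t*); rewrite adjmxM trmxCK; split.
    rewrite !mulmxA -(mulmxA U) -(mulmxA U) -/W WE !mulmxA.
    by rewrite UU mul1mx -mulmxA UU mulmx1.
  by rewrite mulmxA -(mulmxA Y) (unitary_adjmxK _ _ Uu) mulmx1.
pose p i k := complex.Re (`|T k i| ^+ 2).
have pE i k : (p i k)%:C = `|T k i| ^+ 2 by rewrite RRe_real // rpredX // normr_real.
have p0 i k : 0 <= p i k by rewrite -ler0c pE exprn_ge0.
pose d i := \sum_k p i k * lam k.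
have DE i : D 0 i = (d i)%:C.
  have := congr1 (fun A : 'M_M => A i i) TLT.
  rewrite /= [in RHS]mxE eqxx mulr1n => <-.
  rewrite /L mul_mx_diag mxE /d rmorph_sum; apply: eq_bigr => k _.
  by rewrite mxE adjmxE mxE rmorphM /= pE normCK mulrAC [_^*%R * _]mulrC.
exists d, p; split => //.
- move=> k.
  (* [Z] is self-adjoint with [Z L Z = Z]; null streams get weight [0^-1 = 0]. Its diagonal entry
     [z] is therefore the sum of [lam j * |Z k j|^2], and keeping only [j = k] gives
     [lam k * z^2 <= z], hence [lam k * z <= 1]. *)
  pose Z := T *m diag_mx (\row_i (d i)^-1%:C) *m T^t*.
  have Zadj : Z^t* = Z.
    rewrite /Z !adjmxM trmxCK mulmxA; congr (_ *m _ *m _).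
    exact: adjmx_real_diag.
  have ZLZ : Z *m L *m Z = Z.
    rewrite /Z -!mulmxA (mulmxA L) (mulmxA (T^t*)) (mulmxA (T^t*)) TLT.
    rewrite (mulmxA (diag_mx D)) (mulmxA (diag_mx _) (_ *m _)) !mulmx_diag.
    congr (_ *m (diag_mx _ *m _)); apply/rowP => j; rewrite !mxE DE -!rmorphM /=.
    have [->|h] := eqVneq (d j) 0; first by rewrite invr0 mul0r.
    by rewrite divff // mulr1.
  pose z := \sum_i p i k / d i.
  have zE : Z k k = z%:C.
    rewrite /Z mul_mx_diag mxE /z rmorph_sum; apply: eq_bigr => i _.
    by rewrite mxE adjmxE mxE rmorphM /= pE normCK mulrAC.
  have zz : z ^+ 2 * lam k <= z.
    rewrite -lecR -zE -[in leRHS]ZLZ /L mul_mx_diag mxE (bigD1 k) //=.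
    rewrite mxE mxE zE -!rmorphM /= expr2 -mulrA [z * (z * _)]mulrC lerDl.
    apply: sumr_ge0 => j _; rewrite mxE mxE.
    have -> : Z j k = (Z k j)^*%R by rewrite -[in LHS]Zadj adjmxE.
    by rewrite mulrAC -normCK mulr_ge0 ?exprn_ge0 // ler0c.
  have -> : \sum_i p i k * lam k / d i = z * lam k.
    by rewrite /z mulr_suml; apply: eq_bigr => i _; rewrite mulrAC.
  have z0 : 0 <= z * lam k.
    rewrite mulr_ge0 // sumr_ge0 // => i _; rewrite divr_ge0 // sumr_ge0 // => j _.
    by rewrite mulr_ge0.
  have : (z * lam k) ^+ 2 <= z * lam k.
    by rewrite exprMn expr2 expr2 mulrA -expr2 ler_wpM2r.
  by move: z0; set w := z * lam k; nra.
- rewrite trT. rewrite mxtrace_mulC /mxtrace rmorph_sum; apply: eq_bigr => i _.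
  rewrite mxE rmorph_sum; apply: eq_bigr => k _.
  by rewrite adjmxE mulrC -normCK /= pE.
- rewrite -/W WE.
  rewrite -mulmxA det1D_mulmxC -mulmxA UU mulmx1.
  rewrite rmorph_prod /=.
  have -> : 1%:M + diag_mx D = diag_mx (\row_i (1 + d i)%:C).
    apply/matrixP => i j; rewrite !mxE DE rmorphD /=.
    by case: eqVneq => _; rewrite ?mulr1n ?mulr0n ?addr0.
  by rewrite det_diag; apply: eq_bigr => i _; rewrite mxE.
Qed.

End Complex.

(** * Padded, truncated and triangular matrices *)

Lemma pad_cols_gram (R : realType) m q M (hq : (q <= M)%N) (A : 'M[R[i]]_(m, q)) :
  pad_cols hq A *m (pad_cols hq A)^t* = A *m A^t*.
Proof.
(* Generalising [M - q] allows elimination of the equation [q + n = M], which removes the cast. *)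
rewrite /pad_cols; move: (M - q)%N (subnKC hq) => n; clear hq => e.
case: M / e; rewrite castmx_id tr_row_mx map_col_mx mul_row_col.
by rewrite mul0mx addr0.
Qed.

(** Compressing by the first columns of [V] selects a leading principal block; applied to [A = 1]
    and to the channel Gram matrix. *)
Lemma first_cols_congr (R : realType) m K q (hq : (q <= K)%N) (V : 'M[R[i]]_(m, K))
    (A : 'M[R[i]]_m) :
  (first_cols hq V)^t* *m A *m first_cols hq V =
  mxsub (widen_ord hq) (widen_ord hq) (V^t* *m A *m V).
Proof.
apply/matrixP => i j; rewrite !mxE; apply: eq_bigr => k _; rewrite !mxE.
by congr (_ * _); apply: eq_bigr => l _; rewrite !mxE.
Qed.

Lemma mxsub_diag (R : pzSemiRingType) m n (f : 'I_m -> 'I_n) (d : 'rV[R]_n) :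
  injective f -> mxsub f f (diag_mx d) = diag_mx (\row_i d 0 (f i)).
Proof. by move=> fI; apply/matrixP => i j; rewrite !mxE (inj_eq fI). Qed.

Lemma diag_mx_gram (C : numClosedFieldType) n (A : 'M[C]_n) :
  is_diag_mx A -> A *m A^t* = diag_mx (\row_i (`|A i i| ^+ 2)).
Proof.
move=> /diag_mxP[d ->]; rewrite tr_diag_mx map_diag_mx mulmx_diag.
by congr diag_mx; apply/rowP => j; rewrite !mxE eqxx mulr1n normCK.
Qed.

Lemma det_unitriangular (C : numClosedFieldType) n (B : 'M[C]_n) :
  strictly_upper_triangular B -> \det (B + 1%:M) = 1.
Proof.
move=> hB; rewrite -det_tr det_trig.
  by apply: big1 => j _; rewrite !mxE eqxx hB // add0r.
apply/is_trig_mxP => j k jk; rewrite !mxE hB ?(ltnW jk) // add0r.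
by case: eqP => // h; rewrite h ltnn in jk.
Qed.

(** * Determinants of the detector matrices *)

Section Detector.
Context {R : realType} {M K P : nat}.
Variables (H : 'M[R[i]]_(P, K)) (Rvv : 'M[R[i]]_P).

Lemma det_Ree_MMSE (F : 'M[R[i]]_(K, M)) (B : 'M[R[i]]_M) :
  strictly_upper_triangular B ->
  \det (Ree_MMSE H Rvv F B) = (\det (snr_mx H Rvv F))^-1.
Proof.
move=> hB; rewrite /Ree_MMSE !det_mulmx det_inv det_map_mx det_tr.
by rewrite det_unitriangular // rmorph1 mul1r mulr1.
Qed.

Lemma snr_mx_channel (F : 'M[R[i]]_(K, M)) (G : 'M[R[i]]_K) :
  H^t* *m invmx Rvv *m H = G -> snr_mx H Rvv F = 1%:M + F^t* *m G *m F.
Proof. by move=> <-; rewrite /snr_mx !mulmxA. Qed.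

End Detector.

(** * Consequences of the maximality of [r] *)

Section Waterfilling.
Context {R : realType} {K : nat}.
Variables (p0 : R) (lam : 'rV[R]_K) (r : nat).
Hypothesis lam_noninc : forall j k : 'I_K, (j <= k)%N -> lam 0 k <= lam 0 j.
Hypothesis lam_ge0 : forall k : 'I_K, 0 <= lam 0 k.
Hypothesis r_largest : is_largest_active p0 lam r.

Lemma largest_active_gt0 : (0 < r)%N.
Proof. by case: r_largest => [[k _ ->]]. Qed.

Lemma largest_active_lam_gt0 (k : 'I_K) : (k < r)%N -> 0 < lam 0 k.
Proof.
case: r_largest => [[j [lj _] ->] _] kj.
by apply: lt_le_trans lj _; apply: lam_noninc; rewrite -ltnS.
Qed.

(** The 0-based channel [r] fails the activity test: [r * mu + 1/lam_r <= (r + 1)/lam_r]. Cancelling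
    one [1/lam_r] leaves [mu <= 1/lam_r], and later channels are weaker still. *)
Lemma largest_active_inactive (mu : R) (k : 'I_K) :
  r%:R * mu = p0 + \sum_(j < K | (j < r)%N) (lam 0 j)^-1 ->
  (r <= k)%N -> mu * lam 0 k <= 1.
Proof.
move=> muE rk; have rK : (r < K)%N := leq_ltn_trans rk (ltn_ord k).
pose s := Ordinal rK.
have [l0|l0] := eqVneq (lam 0 k) 0; first by rewrite l0 mulr0.
have lk : 0 < lam 0 k by rewrite lt_neqAle eq_sym l0 lam_ge0.
have ls : 0 < lam 0 s by apply: lt_le_trans lk _; apply: lam_noninc.
have : ~ channel_active p0 lam s by move=> /(proj2 r_largest); rewrite ltnn.
move=> nact; have {nact} : ~ ((lam 0 s)^-1 <
    r.+1%:R^-1 * (p0 + \sum_(j < K | (j <= r)%N) (lam 0 j)^-1)).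
  by move=> h; apply: nact; split.
move=> /negP; rewrite -leNgt.
have -> : \sum_(j < K | (j <= r)%N) (lam 0 j)^-1 =
    (lam 0 s)^-1 + \sum_(j < K | (j < r)%N) (lam 0 j)^-1.
  rewrite (bigD1 s) //=; congr (_ + _); apply: eq_bigl => j.
  by rewrite -val_eqE andbC -ltn_neqAle.
rewrite mulrC ler_pdivrMr ?ltr0Sn // addrCA -muE -natr1 mulrDr mulr1 addrC lerD2r.
rewrite mulrC ler_pM2r ?ltr0n ?largest_active_gt0 // => h.
have [mu0|mu0] := leP mu 0.
  by apply: le_trans ler01; rewrite mulr_le0_ge0.
apply: (@le_trans _ _ (mu * lam 0 s)); first by rewrite ler_pM2l //; apply: lam_noninc.
by rewrite -(mulVf (lt0r_neq0 ls)) ler_pM2r.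
Qed.

End Waterfilling.

(** * Upper bound over feasible precoders, and its value at the water-filling precoder *)

Section Transmission.
Context {R : realType} {M K P : nat}.
Variables (H : 'M[R[i]]_(P, K)) (Rvv : 'M[R[i]]_P).
Variables (V : 'M[R[i]]_K) (lam : 'rV[R]_K).
Hypothesis V_unitary : V \is unitarymx.
Hypothesis lam_ge0 : forall k : 'I_K, 0 <= lam 0 k.
Hypothesis channelE :
  H^t* *m invmx Rvv *m H = V *m diag_mx (\row_(k < K) (lam 0 k)%:C) *m V^t*.

(** In the eigenbasis, [V^t* *m F] carries the same power as [F], so its streams obey the
    water-filling bound. The witness [c] records that the complex determinant is a positive real. *)
Lemma det_snr_mx_le (q : nat) (p0 mu : R) (F : 'M[R[i]]_(K, M)) :
  (0 < q)%N -> (q <= K)%N -> (q <= M)%N -> 0 < mu ->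
  (forall j k : 'I_K, (j <= k)%N -> lam 0 k <= lam 0 j) ->
  (forall k : 'I_K, (k < q)%N -> 1 < mu * lam 0 k) ->
  ((q < M)%N -> forall k : 'I_K, (q <= k)%N -> mu * lam 0 k <= 1) ->
  q%:R * mu = p0 + \sum_(k < K | (k < q)%N) (lam 0 k)^-1 ->
  power_feasible p0 F ->
  exists c : R, [/\ \det (snr_mx H Rvv F) = c%:C, 0 < c
    & c <= \prod_(k < K | (k < q)%N) (mu * lam 0 k)].
Proof.
move=> q0 qK qM mu0 lamD act inact muE pw.
have [d [p [p_ge0 drow acol trE detE]]] :=
  stream_decomposition M K (lam 0) (V^t* *m F) lam_ge0.
have d0 i : 0 <= d i by rewrite -drow; apply: sumr_ge0 => k _; rewrite mulr_ge0.
have d1 i : 0 < 1 + d i by rewrite ltr_wpDr.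
have snrE : snr_mx H Rvv F = 1%:M + (V^t* *m F)^t* *m
    diag_mx (\row_k (lam 0 k)%:C) *m (V^t* *m F).
  by rewrite (snr_mx_channel _ _ _ _ channelE) adjmxM trmxCK !mulmxA.
exists (\prod_i (1 + d i)); split; first by rewrite snrE.
  by apply: prodr_gt0.
have mul0 (k : 'I_K) : (k < q)%N -> 0 < mu * lam 0 k.
  by move=> /act; apply: lt_trans.
rewrite -ler_ln ?posrE ?prodr_gt0 // !ln_prod //.
apply: (waterfilling_log_bound M K q (lam 0) mu p0 d p) => //.
rewrite -lecR -trE adjmxM trmxCK mulmxA mxtrace_mulC !mulmxA.
by have /unitarymxP -> := V_unitary; rewrite mul1mx.
Qed.

Section Optimal.
Variables (q : nat) (qK : (q <= K)%N) (qM : (q <= M)%N).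
Variables (Phi : 'M[R[i]]_q) (phi2 : 'I_q -> R) (Psi : 'M[R[i]]_M).
Hypothesis Phi_diag : is_diag_mx Phi.
Hypothesis PhiE : forall i, `|Phi i i| ^+ 2 = (phi2 i)%:C.
Hypothesis Psi_unitary : Psi \is unitarymx.
Let F := first_cols qK V *m pad_cols qM Phi *m Psi.

(** [Psi] and the padding cancel in [F *m F^t*], through which both the power and, by Sylvester's
    identity, the determinant are computed. *)
Lemma precoder_gram :
  F *m F^t* =
  first_cols qK V *m diag_mx (\row_i (phi2 i)%:C) *m (first_cols qK V)^t*.
Proof.
rewrite /F !adjmxM !mulmxA -(mulmxA _ Psi).
have /unitarymxP -> := Psi_unitary; rewrite mulmx1 -(mulmxA (first_cols qK V)).
rewrite pad_cols_gram diag_mx_gram //; congr (_ *m diag_mx _ *m _).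
by apply/rowP => i; rewrite !mxE PhiE.
Qed.

Lemma precoder_power : \tr (F *m F^t*) = (\sum_i phi2 i)%:C.
Proof.
rewrite precoder_gram -mulmxA mxtrace_mulC -mulmxA.
have -> : (first_cols qK V)^t* *m first_cols qK V = 1%:M.
  rewrite -[X in X *m _]mulmx1 first_cols_congr mulmx1 unitary_adjmxK //.
  by apply/matrixP => i j; rewrite !mxE.
rewrite mulmx1 mxtrace_diag rmorph_sum.
by apply: eq_bigr => i _; rewrite mxE.
Qed.

Lemma det_snr_precoder :
  \det (snr_mx H Rvv F) = (\prod_i (1 + phi2 i * lam 0 (widen_ord qK i)))%:C.
Proof.
rewrite (snr_mx_channel _ _ _ _ channelE); set G := V *m _ *m _.
rewrite -(mulmxA _ G) det1D_mulmxC -(mulmxA G) precoder_gram.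
set W := first_cols qK V; set D := diag_mx _.
have WGW : W^t* *m G *m W = diag_mx (\row_i (lam 0 (widen_ord qK i))%:C).
  rewrite first_cols_congr /G !mulmxA unitary_adjmxK // mul1mx -mulmxA.
  rewrite unitary_adjmxK // mulmx1 mxsub_diag; last first.
    by move=> i j /(congr1 val) /= /val_inj.
  by congr diag_mx; apply/rowP => i; rewrite !mxE.
(* A second use of Sylvester's identity reduces to size [q], where both factors are diagonal. *)
clearbody G; rewrite mulmxA det1D_mulmxC !mulmxA WGW /D.
rewrite mulmx_diag rmorph_prod /=.
rewrite (_ : 1%:M + _ = diag_mx (\row_i (1 + lam 0 (widen_ord qK i) * phi2 i)%:C)).
  by rewrite det_diag; apply: eq_bigr => i _; rewrite mxE mulrC.
apply/matrixP => i j; rewrite !mxE rmorphD rmorphM /=.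
by case: eqVneq => _; rewrite ?mulr1n ?mulr0n ?addr0.
Qed.
End Optimal.
End Transmission.

(** * Optimality of the precoder *)

Theorem mainTheorem4
  (R : realType) (M K P : nat)
  (hM : (0 < M)%N) (hK : (0 < K)%N) (hP : (0 < P)%N)
  (hMPK : (M <= minn P K)%N)
  (p0 : R) (hp0 : 0 < p0)
  (H : 'M[R[i]]_(P, K)) (hH : H != 0)
  (Rvv : 'M[R[i]]_P) (hRvv : posdefmx Rvv)
  (V : 'M[R[i]]_K) (hV : V \is unitarymx)
  (lam : 'rV[R]_K)
  (hlam_noninc : forall j k : 'I_K, (j <= k)%N -> lam 0 k <= lam 0 j)
  (hlam_ge0 : forall k : 'I_K, 0 <= lam 0 k)
  (hEVD : H^t* *m invmx Rvv *m H
          = V *m diag_mx (\row_(k < K) (lam 0 k)%:C) *m V^t*)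
  (r : nat) (hr : is_largest_active p0 lam r)
  (q : nat) (hq : q = minn r M)
  (hqK := proj1 (minn_le_dim hMPK hq)) (hqM := proj2 (minn_le_dim hMPK hq))
  (lamq := \row_(i < q) lam 0 (widen_ord hqK i))
  (Phi : 'M[R[i]]_q) (hPhi_diag : is_diag_mx Phi)
  (hPhi_pos : forall i : 'I_q, 0 < Phi i i)
  (hPhi : forall i : 'I_q,
     `|Phi i i| ^+ 2
     = (q%:R^-1 * (p0 + \sum_(j < q) (lamq 0 j)^-1) - (lamq 0 i)^-1)%:C)
  (Phi_pad := pad_cols hqM Phi)
  (S : 'M[R[i]]_M)
  (hS : is_sqrtmx
     (1%:M + Phi_pad^T *m diag_mx (\row_(i < q) (lamq 0 i)%:C) *m Phi_pad) S)
  (Psi : 'M[R[i]]_M) (hPsi : Psi \is unitarymx)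
  (Q U : 'M[R[i]]_M) (hQR : is_QR (S *m Psi) Q U)
  (hU : forall i j : 'I_M, U i i = U j j)
  (Fstar := first_cols hqK V *m Phi_pad *m Psi) :
  power_feasible p0 Fstar
  /\ ((forall (F : 'M[R[i]]_(K, M)) (B B' : 'M[R[i]]_M),
         strictly_upper_triangular B -> strictly_upper_triangular B' ->
         geometric_MSE H Rvv F B = geometric_MSE H Rvv F B')
      /\ (forall (F : 'M[R[i]]_(K, M)) (B : 'M[R[i]]_M),
         power_feasible p0 F -> strictly_upper_triangular B ->
         geometric_MSE H Rvv Fstar B <= geometric_MSE H Rvv F B))
  /\ (forall F : 'M[R[i]]_(K, M),
        power_feasible p0 F ->
        mutual_info H Rvv F <= mutual_info H Rvv Fstar).

Proof.
have q_gt0 : (0 < q)%N by rewrite hq leq_min (largest_active_gt0 _ _ _ hr).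
pose sigma := \sum_(j < q) (lamq 0 j)^-1.
pose mu := q%:R^-1 * (p0 + sigma).
have qR : q%:R != 0 :> R by rewrite pnatr_eq0 -lt0n.
have sigmaE : sigma = \sum_(k < K | (k < q)%N) (lam 0 k)^-1.
  by rewrite (big_ord_narrow hqK); apply: eq_bigr => j _; rewrite mxE.
have muE : q%:R * mu = p0 + sigma by rewrite mulVKf.
have lam_gt0 (k : 'I_K) : (k < q)%N -> 0 < lam 0 k.
  move=> kq; apply: (largest_active_lam_gt0 _ _ _ hlam_noninc hr).
  by rewrite (leq_trans kq) // hq geq_minl.
have sigma_ge0 : 0 <= sigma.
  by apply: sumr_ge0 => j _; rewrite mxE invr_ge0.
have mu_gt0 : 0 < mu by rewrite mulr_gt0 ?invr_gt0 ?ltr0n // ltr_wpDr.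
(* Each squared modulus [mu - 1/lam k] is positive because the diagonal of [Phi] is. *)
have active (k : 'I_K) : (k < q)%N -> 1 < mu * lam 0 k.
  move=> kq; have lk := lam_gt0 k kq.
  have := hPhi (Ordinal kq); rewrite mxE -/sigma -/mu.
  rewrite (_ : widen_ord hqK (Ordinal kq) = k); last exact: val_inj.
  move=> PhiE; have : 0 < (mu - (lam 0 k)^-1)%:C.
    by rewrite -PhiE exprn_gt0 // normr_gt0 gt_eqF.
  by rewrite ltcR subr_gt0 -[1](mulVf (lt0r_neq0 lk)) ltr_pM2r.
(* Here [q < M] forces [q = r], so [mu] is the level for [r] channels and maximality of [r]
   applies. *)
have inactive : (q < M)%N -> forall k : 'I_K, (q <= k)%N -> mu * lam 0 k <= 1.
  move=> qM; have qr : q = r.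
    rewrite hq; apply/minn_idPl; rewrite leqNgt; apply/negP => Mr.
    by move: qM; rewrite hq (minn_idPr (ltnW Mr)) ltnn.
  move=> k; rewrite qr; apply: (largest_active_inactive p0 _ _ hlam_noninc hlam_ge0 hr).
  by rewrite -qr muE sigmaE.
pose phi2 (i : 'I_q) := mu - (lamq 0 i)^-1.
pose best := \prod_(k < K | (k < q)%N) (mu * lam 0 k).
(* The bound is attained, since [1 + (mu - 1/lam_i) * lam_i = mu * lam_i]. *)
have detF : \det (snr_mx H Rvv Fstar) = best%:C.
  rewrite (det_snr_precoder _ _ _ _ hV hEVD _ hqK hqM _ phi2 _ hPhi_diag hPhi hPsi).
  congr (_%:C); rewrite /best (big_ord_narrow hqK); apply: eq_bigr => i _.
  have -> : phi2 i = mu - (lam 0 (widen_ord hqK i))^-1 by rewrite /phi2 mxE.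
  by rewrite mulrBl mulVf ?gt_eqF ?lam_gt0 //= addrC subrK.
have bound (F : 'M[R[i]]_(K, M)) : power_feasible p0 F ->
    exists c : R, [/\ \det (snr_mx H Rvv F) = c%:C, 0 < c & c <= best].
  move=> pF; apply: (det_snr_mx_le _ _ _ _ hV hlam_ge0 hEVD q p0 mu) => //.
  by rewrite -sigmaE.
have best_gt0 : 0 < best.
  by apply: prodr_gt0 => k kq; rewrite mulr_gt0 ?lam_gt0.
split; last split; first 1 last.
- split=> [F B B' hB hB'|F B pF hB]; first by rewrite /geometric_MSE !det_Ree_MMSE.
  have [c [detc c0 cb]] := bound F pF.
  rewrite /geometric_MSE !det_Ree_MMSE // detF detc -!fmorphV /=.
  by rewrite ler_rootC ?nnegrE ?ler0c ?invr_ge0 ?lecR ?lef_pV2 // ltW.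
- move=> F pF; have [c [detc c0 cb]] := bound F pF.
  by rewrite /mutual_info detc detF ler_ln.
(* The whole budget is spent: [q * mu - sigma = p0]. *)
rewrite /power_feasible (precoder_power _ hV _ hqK hqM _ phi2 _ hPhi_diag hPhi hPsi).
rewrite lecR sumrB -/sigma sumr_const card_ord -mulr_natl muE.
by rewrite addrK.
Qed.
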